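(* Let $\mathfrak{A}$ be a unital $C^*$-algebra with unit $\boldsymbol{1}$ and let $a\in\mathfrak{A}$ be a non-zero element such that $a\parallel\boldsymbol{1}$. Then the following conditions are equivalent: (i) $\|a\|=1$. (ii) $dw_{\mathfrak{A}}(a)=\sqrt{2}\,w_{\mathfrak{A}}(a)$.
   Context: $\mathfrak{A}$ is a complex unital $C^*$-algebra; its state space $\mathfrak{S}(\mathfrak{A})$ is the set of all positive linear functionals $f\in\mathfrak{A}^*$ with $\|f\|=f(\boldsymbol{1})=1$. For $a\in\mathfrak{A}$: the algebraic numerical radius is $w_{\mathfrak{A}}(a)=\sup\{|f(a)|:f\in\mathfrak{S}(\mathfrak{A})\}$; the algebraic Davis--Wielandt radius is $dw_{\mathfrak{A}}(a)=\sup\{\sqrt{|f(a)|^2+f(a^*a)^2}:f\in\mathfrak{S}(\mathfrak{A})\}$. Two elements $a,b\in\mathfrak{A}$ are norm-parallel, written $a\parallel b$, if there exists $\lambda\in\mathbb{T}=\{z\in\mathbb{C}:|z|=1\}$ such that $\|a+\lambda b\|=\|a\|+\|b\|$. *)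

(* Defs.v *)
From HB Require Import structures.
From mathcomp Require Import all_boot all_order all_algebra.
From mathcomp Require Import complex.
From mathcomp Require Import all_classical all_reals all_analysis.

Set Implicit Arguments.
Unset Strict Implicit.
Unset Printing Implicit Defensive.

Import Order.TTheory GRing.Theory Num.Theory.
Import numFieldNormedType.Exports.
Import ComplexField.Normc.

Local Open Scope classical_set_scope.
Local Open Scope complex_scope.
Local Open Scope ring_scope.

(* Complex scalars are R[i] with R : realType, so the norm of A takes values
   in R[i] (where 0 <= z says that z is a nonnegative real).
   The product is a field of the mixin instead of being inherited from algType:
   MathComp admits no structure joining normedModType and a ring type other
   than numDomainType, whose product is commutative. The algType structure is
   recovered below as instances on any A : cstarAlgType R.
   As for every nzRingType, the null algebra is excluded. *)
HB.mixin Record isCStarAlgebra (R : realType) A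
    & CompleteNormedModule R[i] A := {
  cstar_one : A;
  cstar_mul : A -> A -> A;
  star : A -> A;
  cstar_mulA : associative cstar_mul;
  cstar_mul1l : left_id cstar_one cstar_mul;
  cstar_mul1r : right_id cstar_one cstar_mul;
  cstar_mulDl : left_distributive cstar_mul +%R;
  cstar_mulDr : right_distributive cstar_mul +%R;
  cstar_one_neq0 : cstar_one != 0;
  cstar_scaleAl : forall (k : R[i]) (x y : A),
    k *: cstar_mul x y = cstar_mul (k *: x) y;
  cstar_scaleAr : forall (k : R[i]) (x y : A),
    k *: cstar_mul x y = cstar_mul x (k *: y);
  starK : involutive star;
  starD : {morph star : x y / x + y};
  starZ : forall (k : R[i]) (x : A), star (k *: x) = k^* *: star x;
  starM : forall x y : A,
    star (cstar_mul x y) = cstar_mul (star y) (star x);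
  cstar_normM : forall x y : A, `|cstar_mul x y| <= `|x| * `|y|;
  cstar_norm : forall x : A, `|cstar_mul (star x) x| = `|x| ^+ 2;
}.

#[short(type="cstarAlgType")]
HB.structure Definition CStarAlgebra (R : realType) :=
  {A of isCStarAlgebra R A & CompleteNormedModule R[i] A}.

#[non_forgetful_inheritance]
HB.instance Definition _ (R : realType) (A : cstarAlgType R) :=
  GRing.Zmodule_isNzRing.Build A (@cstar_mulA R A) (@cstar_mul1l R A)
    (@cstar_mul1r R A) (@cstar_mulDl R A) (@cstar_mulDr R A)
    (@cstar_one_neq0 R A).
#[non_forgetful_inheritance]
HB.instance Definition _ (R : realType) (A : cstarAlgType R) :=
  GRing.Lmodule_isLalgebra.Build R[i] A (@cstar_scaleAl R A).
#[non_forgetful_inheritance]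
HB.instance Definition _ (R : realType) (A : cstarAlgType R) :=
  GRing.Lalgebra_isAlgebra.Build R[i] A (@cstar_scaleAr R A).

Section NumericalRadii.
Context (R : realType) (A : cstarAlgType R).
Implicit Types (f : {linear A -> R[i]^o}) (a b x : A).

Definition positive_functional f : Prop := forall x, 0 <= f (star x * x).

(* normc : R[i] -> R is the modulus as an element of R; the supremum is
   meaningful for continuous f only, since sup is 0 on unbounded sets. *)
Definition dual_norm f : R := sup [set normc (f x) | x in [set x | `|x| <= 1]].

Definition state_space : set {linear A -> R[i]^o} :=
  [set f : {linear A -> R[i]^o} |
    [/\ continuous f, positive_functional f, dual_norm f = 1 & f 1 = 1]].

Definition numerical_radius a : R := sup [set normc (f a) | f in state_space].

(* f (star a * a) is a nonnegative real for f in state_space, so that Re only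
   casts it from R[i] to R. *)
Definition davis_wielandt_radius a : R :=
  sup [set Num.sqrt (normc (f a) ^+ 2 + complex.Re (f (star a * a)) ^+ 2)
      | f in state_space].

Definition norm_parallel a b : Prop :=
  exists l : R[i], `|l| = 1 /\ `|a + l *: b| = `|a| + `|b|.

End NumericalRadii.

(* Main.v *)
(* A functional g of norm 1 with g (a + l 1) = |a + l 1| = |a| + 1 satisfies
   |g a| <= |a| and |g 1| <= 1, so both are equalities and f := l g has f 1 = 1
   and |f a| = |a|. Once f is known to be positive, it is a state, whence
   w a = |a|; as |f a|^2 <= f (a^* a) <= |a|^2, it also attains
   dw a = sqrt (|a|^2 + |a|^4), and the equivalence is arithmetic.

   Positivity of f, from f 1 = 1 and |f x| <= |x| only: for h selfadjoint,
   u := 2 - h^2 + 2ih has u^* u = 4 + h^4, so |f u|^2 <= 4 + |h|^4, and scaling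
   h down gives f (h^2) >= 0. For x arbitrary with |x| <= 1, let h := x^* x,
   k := x x^* and y := x (1 - h)^n. Then
     y^* y = (1 - h)^(2n) h  and  y y^* = (1 - k)^(2n) k,
   and y^* y + y y^* is a sum of two selfadjoint squares. If f h < 0, then
   f ((1 - h)^(2n) h) <= - n (f h)^2 while f ((1 - k)^(2n) k) <= f k <= 1,
   which is absurd for n large. *)

Require Import Defs.
From HB Require Import structures.
From mathcomp Require Import all_boot all_order all_algebra.
From mathcomp Require Import complex.
From mathcomp Require Import all_classical all_reals all_analysis.
From mathcomp Require Import ring lra.
Set Implicit Arguments.
Unset Strict Implicit.
Unset Printing Implicit Defensive.
Import Order.TTheory GRing.Theory Num.Theory.
Import numFieldNormedType.Exports.
Local Open Scope ring_scope.

(** * Hahn-Banach for sublinear functionals on the underlying real space *)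

Section SublinearFunctionals.
Context (R : realType) (V : lmodType R[i]).
Implicit Types (p : V -> R) (x y b : V) (r t : R).
Local Open Scope complex_scope.

(** Homogeneity is asked as an inequality only, so that it passes directly to infima; scaling back
    by [r^-1] restores equality. *)
Definition sublinear p : Prop :=
  (forall x y, p (x + y) <= p x + p y) /\
  (forall r x, 0 < r -> p (r%:C *: x) <= r * p x).

Lemma sublinearZ p r x : sublinear p -> 0 < r -> p (r%:C *: x) = r * p x.
Proof.
move=> [_ pZ] r0; apply/eqP; rewrite eq_le pZ //= -ler_pdivlMl //.
have -> : p x = p (r^-1%:C *: (r%:C *: x)).
  by rewrite scalerA -rmorphM /= mulVf ?gt_eqF // rmorph1 scale1r.
by rewrite pZ ?invr_gt0.
Qed.

Lemma sublinear0 p : sublinear p -> p 0 = 0.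
Proof.
move=> sp; have /(_ ltac:(lra)) := @sublinearZ p 2 0 sp.
by rewrite scaler0; lra.
Qed.

Lemma sublinear_geN p x : sublinear p -> - p (- x) <= p x.
Proof.
move=> sp; have := sp.1 x (- x); rewrite subrr (sublinear0 sp); lra.
Qed.

(* The largest sublinear functional below [p] taking the value [- p b] at
   [- b]. *)
Definition pull p b x : R :=
  inf [set p (x + t%:C *: b) - t * p b | t in [set t | 0 <= t]]%classic.

(** Subadditivity for [t b = (x + t b) + (- x)]. A lower bound is what makes the [inf] in [pull]
    meaningful. *)
Lemma pull_has_lbound p b x : sublinear p ->
  lbound [set p (x + t%:C *: b) - t * p b | t in [set t | 0 <= t]]%classic
    (- p (- x)).
Proof.
move=> sp _ [t /= t0 <-].
have -> : t * p b = p (t%:C *: b).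
  move: t0; rewrite le_eqVlt => /orP[/eqP <-|/(sublinearZ _ sp)->//].
  by rewrite scale0r mul0r (sublinear0 sp).
have := sp.1 (x + t%:C *: b) (- x).
by rewrite addrAC subrr add0r; lra.
Qed.

Lemma pull_le p b x t : sublinear p -> 0 <= t ->
  pull p b x <= p (x + t%:C *: b) - t * p b.
Proof.
move=> sp t0; apply: ge_inf; last by exists t.
by exists (- p (- x)); exact: pull_has_lbound.
Qed.

Lemma le_pull p b x c :
  (forall t, 0 <= t -> c <= p (x + t%:C *: b) - t * p b) -> c <= pull p b x.
Proof.
move=> H; apply: lb_le_inf; last by move=> _ [t /= t0 <-]; exact: H.
by exists (p (x + 0%:C *: b) - 0 * p b); exists 0 => //=.
Qed.

Lemma pull_le_id p b x : sublinear p -> pull p b x <= p x.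
Proof.
move=> sp; have := pull_le b x sp (lexx 0).
by rewrite scale0r addr0 mul0r subr0; apply.
Qed.

Lemma pull_sublinear p b : sublinear p -> sublinear (pull p b).
Proof.
move=> sp; split=> [x y|r x r0].
  rewrite -lerBlDr; apply: le_pull => t t0.
  rewrite lerBlDr -lerBlDl; apply: le_pull => s s0.
  (* Parameters [t] for [x] and [s] for [y] combine into [t + s] for [x + y]. *)
  rewrite lerBlDl; apply: (le_trans (pull_le b _ sp (addr_ge0 t0 s0))).
  have := sp.1 (x + t%:C *: b) (y + s%:C *: b).
  rewrite addrACA -scalerDl -rmorphD /= mulrDl; lra.
rewrite -ler_pdivrMl //; apply: le_pull => t t0; rewrite ler_pdivrMl //.
apply: (le_trans (pull_le b _ sp (mulr_ge0 (ltW r0) t0))).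
by rewrite rmorphM /= -scalerA -scalerDr (sublinearZ _ sp r0) mulrBr mulrA.
Qed.

Lemma pullN p b : sublinear p -> pull p b (- b) <= - p b.
Proof.
move=> sp; have := pull_le b (- b) sp ler01.
by rewrite rmorph1 scale1r addNr (sublinear0 sp) mul1r sub0r.
Qed.

Lemma sublinear_minimal p : sublinear p ->
  exists2 q, sublinear q /\ (forall x, q x <= p x) &
    forall s, sublinear s -> (forall x, s x <= q x) -> s = q.
Proof.
move=> sp.
pose T := {q | sublinear q /\ (forall x, q x <= p x)}.
(* The order is reversed, so that a maximal element in the sense of Zorn is a pointwise minimal
   functional. *)
pose below (q s : T) := `[< forall x, sval s x <= sval q x >].
have [||||[q [sq qp]] qmin] := @Zorn T below.
- by move=> q; apply/asboolP.
- move=> q s u /asboolP qs /asboolP su; apply/asboolP => x.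
  exact: le_trans (su x) (qs x).
- move=> [q Hq] [s Hs] /asboolP /= qs /asboolP /= sq; apply: eq_exist => /=.
  by apply/funext => x; apply/eqP; rewrite eq_le qs sq.
(* The empty chain is bounded by [p]; a nonempty one by its pointwise infimum, finite because each
   member is at least [- p (- x)] at [x]. *)
- move=> F Ftot; have [[q0 Fq0]|F0] := pselect (exists q, F q); last first.
    by exists (exist _ p (conj sp (fun=> lexx _))) => s Fs; case: F0; exists s.
  pose m x := inf [set sval q x | q in F]%classic.
  have m_le q x : F q -> m x <= sval q x.
    move=> Fq; apply: ge_inf; last by exists q.
    exists (- p (- x)) => _ [s Fs <-]; case: (svalP s) => ss sp'.
    apply: le_trans (sublinear_geN x ss); rewrite lerN2; exact: sp'.
  have le_m c x : (forall q, F q -> c <= sval q x) -> c <= m x.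
    move=> H; apply: lb_le_inf; last by move=> _ [s Fs <-]; exact: H.
    by exists (sval q0 x); exists q0.
  have sm : sublinear m.
    split=> [x y|r x r0].
      rewrite -lerBlDr; apply: (le_m) => q Fq.
      rewrite lerBlDr -lerBlDl; apply: (le_m) => s Fs; rewrite lerBlDl.
      (* Of [q] and [s] one lies below the other, and subadditivity of the smaller one suffices. *)
      have [/asboolP H|/asboolP H] := Ftot q s Fq Fs.
        apply: (le_trans (m_le s _ Fs)); apply: (le_trans ((svalP s).1.1 x y)).
        by rewrite lerD2r H.
      apply: (le_trans (m_le q _ Fq)); apply: (le_trans ((svalP q).1.1 x y)).
      by rewrite lerD2l H.
    rewrite -ler_pdivrMl //; apply: (le_m) => q Fq; rewrite ler_pdivrMl //.
    exact: le_trans (m_le q _ Fq) ((svalP q).1.2 r x r0).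
  have mp x : m x <= p x by apply: (le_trans (m_le q0 x Fq0)); case: (svalP q0).
  exists (exist _ m (conj sm mp)) => s Fs; apply/asboolP => x; exact: m_le.
exists q => // s ss sq'.
have sp' x : s x <= p x by exact: le_trans (sq' x) (qp x).
have /(_ (exist _ s (conj ss sp'))) := qmin; rewrite /below.
by move=> /(_ ltac:(apply/asboolP; exact: sq'))/(congr1 sval).
Qed.

(** A minimal [u] below [pull p b] is additive: [pull u y] is sublinear and below [u], hence equal
    to [u], and its bound at [t = 1] reads [u x <= u (x + y) - u y]. Then [- u b = u (- b) <= - p b]
    gives the value at [b]. *)
Lemma hahn_banach_sublinear p b : sublinear p -> exists u : V -> R,
  [/\ {morph u : x y / x + y}, forall r x, u (r%:C *: x) = r * u x,
      forall x, u x <= p x & u b = p b].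
Proof.
move=> sp; have [u [su ub] umin] := sublinear_minimal (pull_sublinear b sp).
have uD : {morph u : x y / x + y}.
  move=> x y; apply/eqP; rewrite eq_le su.1 /= -lerBrDr.
  rewrite -{1}(umin (pull u y)); first last.
  - by move=> z; exact: pull_le_id.
  - exact: pull_sublinear.
  by have := pull_le y x su ler01; rewrite rmorph1 scale1r mul1r.
have uN x : u (- x) = - u x.
  by apply/eqP; rewrite -addr_eq0 -uD addNr (sublinear0 su).
have up x : u x <= p x by exact: le_trans (ub x) (pull_le_id b x sp).
exists u; split=> //.
- move=> r x; have [r0|r0|->] := ltgtP r 0; last first.
  + by rewrite scale0r mul0r (sublinear0 su).
  + exact: sublinearZ.
  have := @sublinearZ u (- r) x su; rewrite oppr_gt0 => /(_ r0).
  by rewrite rmorphN scaleNr uN mulNr => /oppr_inj.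
- apply/eqP; rewrite eq_le up /=; have := le_trans (ub (- b)) (pullN b sp).
  by rewrite uN lerN2.
Qed.

End SublinearFunctionals.

(** * The norm and the modulus with values in the reals *)

Section RealNorm.
Context (R : realType) (V : normedModType R[i]).
Implicit Types (x y : V) (r : R) (z : R[i]).
Local Open Scope complex_scope.

Definition rnorm x : R := complex.Re `|x|.

Lemma rnormE x : `|x| = (rnorm x)%:C.
Proof. by rewrite /rnorm RRe_real ?normr_real. Qed.

Lemma normr_normc z : `|z| = (ComplexField.Normc.normc z)%:C.
Proof. by []. Qed.

Lemma rnorm_ge0 x : 0 <= rnorm x.
Proof. by rewrite -lecR -rnormE normr_ge0. Qed.

Lemma rnormD x y : rnorm (x + y) <= rnorm x + rnorm y.
Proof. by rewrite -lecR rmorphD /= -!rnormE ler_normD. Qed.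

Lemma rnormZ z x : rnorm (z *: x) = ComplexField.Normc.normc z * rnorm x.
Proof. by apply: complexI; rewrite rmorphM /= -!rnormE normrZ normr_normc. Qed.

Lemma normc_real r : 0 <= r -> ComplexField.Normc.normc r%:C = r.
Proof. by move=> r0; rewrite /= expr0n addr0 sqrtr_sqr ger0_norm. Qed.

Lemma rnorm_sublinear : sublinear rnorm.
Proof.
by split=> [|r x r0]; [exact: rnormD | rewrite rnormZ normc_real// ltW].
Qed.

Lemma Re_le_normc z : complex.Re z <= ComplexField.Normc.normc z.
Proof.
case: z => a b /=; apply: (le_trans (ler_norm a)).
by rewrite -sqrtr_sqr ler_wsqrtr// lerDl sqr_ge0.
Qed.

Lemma normc_sqr z :
  ComplexField.Normc.normc z ^+ 2 = complex.Re z ^+ 2 + complex.Im z ^+ 2.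
Proof. by case: z => a b /=; rewrite sqr_sqrtr// addr_ge0 ?sqr_ge0. Qed.

Lemma normc_ge0 z : 0 <= ComplexField.Normc.normc z.
Proof. by case: z => a b; exact: sqrtr_ge0. Qed.

End RealNorm.

(** * Norming functionals on a complex normed space *)

Section NormingFunctional.
Context (R : realType) (V : normedModType R[i]).
Implicit Types (x y b : V) (r : R).
Local Open Scope complex_scope.

Section Complexification.
Variable u : V -> R.
Hypotheses (uD : {morph u : x y / x + y})
           (uZ : forall r x, u (r%:C *: x) = r * u x).

(** The only possible complex-linear functional with real part [u]: complex linearity forces
    [Im (g x) = - Re (g (i x))]. *)
Definition complexify x : R[i]^o := u x +i* (- u ('i *: x)).

Lemma complexify_linear : linear complexify.
Proof.
move=> [c d] x y; rewrite /complexify.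
have -> : (c +i* d) = c%:C + d%:C * 'i%C by simpc.
have uZD (r s : R) z w : u (r%:C *: z + s%:C *: w) = r * u z + s * u w.
  by rewrite uD !uZ.
have -> : (c%:C + d%:C * 'i%C) *: x = c%:C *: x + d%:C *: ('i%C *: x).
  by rewrite scalerDl scalerA.
have -> : 'i%C *: (c%:C *: x + d%:C *: ('i%C *: x) + y) =
    c%:C *: ('i%C *: x) + (- d)%:C *: x + 'i%C *: y.
  rewrite !scalerDr !scalerA [c%:C * _]mulrC; congr (_ + _ *: x + _).
  by simpc.
rewrite !(uD (_ + _)) !uZD.
apply/eqP; rewrite eq_complex /=; apply/andP; split; apply/eqP; ring.
Qed.

End Complexification.

(** Multiplying [x] by a scalar [c] of modulus 1 turns [f x] into its modulus without changing the
    norm of [x]. *)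
Lemma linear_normc_le (f : {linear V -> R[i]^o}) :
  (forall x, complex.Re (f x) <= rnorm x) ->
  forall x, ComplexField.Normc.normc (f x) <= rnorm x.
Proof.
move=> ule x; set z : R[i] := f x.
have [z0|z0] := eqVneq z 0.
  by rewrite z0 ComplexField.Normc.normc0 rnorm_ge0.
pose n := ComplexField.Normc.normc z.
have n0 : n != 0 by apply: contra_neq z0; exact: ComplexField.Normc.eq0_normc.
pose c : R[i] := n%:C / z.
have nc : ComplexField.Normc.normc c = 1.
  by rewrite ComplexField.Normc.normcM ComplexField.Normc.normcV
     normc_real ?normc_ge0// mulfV.
have := ule (c *: x); rewrite rnormZ nc mul1r; apply: le_trans.
have : f (c *: x) = n%:C.
  by rewrite linearZ_LR; exact: divfK.
by move=> ->.
Qed.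

Lemma exists_norming_functional b : exists f : {linear V -> R[i]^o},
  (forall x, ComplexField.Normc.normc (f x) <= rnorm x) /\
  complex.Re (f b) = rnorm b.
Proof.
have [u [uD uZ ule ub]] := hahn_banach_sublinear b (rnorm_sublinear V).
pose HB := GRing.isLinear.Build R[i] V R[i]^o _ (complexify u)
  (complexify_linear uD uZ).
pose f : {linear V -> R[i]^o} := HB.pack (complexify u) HB.
exists f; split=> [x|]; last exact: ub.
exact: linear_normc_le.
Qed.

End NormingFunctional.

(** * Involution and norm in a C*-algebra *)

Section CStarTheory.
Context (R : realType) (A : cstarAlgType R).
Implicit Types (x y h k s : A) (r : R) (z : R[i]).
Local Open Scope complex_scope.

Lemma starMr x y : star (x * y) = star y * star x.
Proof. exact: starM. Qed.

Lemma star1 : star (1 : A) = 1.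
Proof. by rewrite -[RHS]starK -[star 1 in RHS]mulr1 starMr starK mulr1. Qed.

Lemma star0 : star (0 : A) = 0.
Proof. by apply: (addrI (star 0)); rewrite -starD !addr0. Qed.

Lemma starN x : star (- x) = - star x.
Proof. by apply/eqP; rewrite -addr_eq0 -starD addNr star0. Qed.

Lemma starB x y : star (x - y) = star x - star y.
Proof. by rewrite starD starN. Qed.

Lemma starX x n : star (x ^+ n) = star x ^+ n.
Proof.
elim: n => [|n IHn]; first by rewrite !expr0 star1.
by rewrite exprSr exprS starMr IHn.
Qed.

Lemma starZr r x : star (r%:C *: x) = r%:C *: star x.
Proof.
rewrite starZ; congr (_ *: _).
by apply/eqP; rewrite eq_complex /= oppr0 !eqxx.
Qed.

Lemma starZi x : star ('i%C *: x) = - ('i%C *: star x).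
Proof.
rewrite starZ -scaleNr; congr (_ *: _).
by apply/eqP; rewrite eq_complex /= oppr0 !eqxx.
Qed.

Lemma rnormM x y : rnorm (x * y) <= rnorm x * rnorm y.
Proof. by rewrite -lecR rmorphM /= -!rnormE cstar_normM. Qed.

Lemma rnorm_starM x : rnorm (star x * x) = rnorm x ^+ 2.
Proof. by apply: complexI; rewrite rmorphXn /= -!rnormE cstar_norm. Qed.

(** Cancel [|y|] in [|y|^2 = |y^* y| <= |y^*| |y|]; the converse bound is the same one at
    [star x]. *)
Lemma rnorm_star x : rnorm (star x) = rnorm x.
Proof.
suff le y : rnorm y <= rnorm (star y).
  by apply/eqP; rewrite eq_le le andbT -{2}[x]starK le.
have [->|y0] := eqVneq (rnorm y) 0; first exact: rnorm_ge0.
have {}y0 : 0 < rnorm y by rewrite lt_def y0 rnorm_ge0.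
by have := rnormM (star y) y; rewrite rnorm_starM expr2 ler_pM2r.
Qed.

Lemma rnorm1 : rnorm (1 : A) = 1.
Proof.
have := rnorm_starM 1; rewrite star1 mulr1 => e.
have n0 : rnorm (1 : A) != 0.
  apply/eqP => n0; have : `|1 : A| = 0 by rewrite rnormE n0.
  by move/eqP; rewrite normr_eq0 oner_eq0.
by apply: (mulfI n0); rewrite mulr1 [RHS]e expr2.
Qed.

Lemma rnormX x n : rnorm (x ^+ n) <= rnorm x ^+ n.
Proof.
elim: n => [|n IHn]; first by rewrite !expr0 rnorm1.
rewrite !exprS; apply: (le_trans (rnormM _ _)).
by rewrite ler_wpM2l ?rnorm_ge0.
Qed.

End CStarTheory.

(** * Square identities for commuting elements *)

Lemma subr_sqr_comm (S : nzRingType) (x y : S) :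
  GRing.comm x y -> (x - y) * (x + y) = x ^+ 2 - y ^+ 2.
Proof. by move=> xy; rewrite mulrBl !mulrDr xy addrKA -!expr2. Qed.

Lemma sqrrB_comm (S : nzRingType) (x y : S) :
  GRing.comm x y -> (x - y) ^+ 2 = x ^+ 2 - x * y *+ 2 + y ^+ 2.
Proof.
move=> xy; rewrite expr2 mulrBl !mulrBr -xy opprB mulr2n opprD !addrA.
by rewrite [RHS]addrAC.
Qed.

(** * Positivity of unital contractive functionals *)

Section UnitalContractiveFunctional.
Context (R : realType) (A : cstarAlgType R) (f : {linear A -> R[i]^o}).
Implicit Types (x y h k s : A) (r : R).
Local Open Scope complex_scope.
Local Notation normc := ComplexField.Normc.normc.
Hypotheses (f1 : f 1 = 1) (f_le : forall x, normc (f x) <= rnorm x).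
Local Notation F x := (complex.Re (f x)).

Lemma ReD x y : F (x + y) = F x + F y.
Proof. by rewrite linearD; case: (f x) (f y) => ? ? []. Qed.

Lemma ReN x : F (- x) = - F x.
Proof. by rewrite linearN; case: (f x). Qed.

Lemma ReB x y : F (x - y) = F x - F y.
Proof. by rewrite ReD ReN. Qed.

Lemma ReZr r x : F (r%:C *: x) = r * F x.
Proof. by rewrite linearZ_LR; case: (f x) => c d /=; rewrite mul0r subr0. Qed.

Lemma ReZi x : F ('i%C *: x) = - complex.Im (f x).
Proof.
by rewrite linearZ_LR; case: (f x) => c d /=; rewrite mul0r mul1r sub0r.
Qed.

Lemma ImD x y : complex.Im (f (x + y)) = complex.Im (f x) + complex.Im (f y).
Proof. by rewrite linearD; case: (f x) (f y) => ? ? []. Qed.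

Lemma ImZi x : complex.Im (f ('i%C *: x)) = F x.
Proof.
by rewrite linearZ_LR; case: (f x) => c d /=; rewrite mul0r mul1r add0r.
Qed.

Lemma Re1 : F 1 = 1.
Proof. by rewrite f1. Qed.

Lemma Re_le x : F x <= rnorm x.
Proof. exact: le_trans (Re_le_normc _) (f_le x). Qed.

Lemma Im_selfadjoint h : star h = h -> complex.Im (f h) = 0.
Proof.
move=> hh; apply/eqP; apply: contraT => b0.
(* Comparing [f v] with the norm of [v = h + i t] gives [(b + t)^2 <= |h|^2 + t^2]. As
   [b t = |h|^2], this becomes [b^2 + |h|^2 <= 0]. *)
pose b := complex.Im (f h); pose t := rnorm h ^+ 2 / b.
pose v := h + 'i%C *: (t%:C *: 1).
have nv : rnorm v ^+ 2 <= rnorm h ^+ 2 + t ^+ 2.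
  rewrite -rnorm_starM.
  have -> : star v * v = h ^+ 2 + (t ^+ 2)%:C *: 1.
    rewrite starD hh starZi starZr star1 subr_sqr_comm; last first.
      by rewrite /GRing.comm scalerA -scalerAl -scalerAr mul1r mulr1.
    rewrite scalerA exprZn expr1n exprMn sqr_i mulN1r scaleNr opprK.
    by rewrite rmorphXn.
  apply: (le_trans (rnormD _ _)).
  rewrite rnormZ rnorm1 mulr1 normc_real ?sqr_ge0// lerD2r.
  exact: rnormX.
have fv : (b + t) ^+ 2 <= normc (f v) ^+ 2.
  have -> : b + t = complex.Im (f v).
    by rewrite ImD ImZi ReZr Re1 mulr1.
  by rewrite normc_sqr lerDr sqr_ge0.
have : normc (f v) ^+ 2 <= rnorm v ^+ 2.
  by rewrite lerXn2r ?nnegrE ?normc_ge0 ?rnorm_ge0.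
move=> H; have {H} := le_trans fv (le_trans H nv).
have bt : b * t = rnorm h ^+ 2 by rewrite /t mulrC divfK.
have : 0 < b ^+ 2 by rewrite exprn_even_gt0.
have := sqr_ge0 (rnorm h); move: bt; set N := rnorm h ^+ 2.
nra.
Qed.

(** The element [c + v] is the second-order Taylor polynomial of [2 exp (i h)], twice a unitary;
    hence [(c + v)^* (c + v)] differs from 4 by [h^4] only. *)
Lemma Re_sqr_approx h : star h = h -> - F (h ^+ 2) *+ 4 <= rnorm h ^+ 4.
Proof.
move=> hh; pose c := 2%:R - h ^+ 2; pose v := 'i%C *: (h *+ 2).
have cv : c * v = v * c.
  rewrite /v -scalerAl -scalerAr; congr (_ *: _).
  apply: (commrMn _); apply/commr_sym; apply: commrB; last exact: commrX.
  exact: commr_nat.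
have sc : star c = c by rewrite starB starX hh mulr2n starD star1.
have sv : star v = - v by rewrite starZi mulr2n starD hh -mulr2n.
have E : star (c + v) * (c + v) = 4%:R + h ^+ 4.
  rewrite starD sc sv subr_sqr_comm // /v exprZn sqr_i scaleN1r opprK exprMn_n.
  rewrite /c sqrrB_comm; last exact/commr_sym/commr_nat.
  rewrite -exprM -natrX mulr_natl -mulrnA addrAC subrK //.
have FE : 2 - F (h ^+ 2) = F (c + v).
  by rewrite !ReD ReN Re1 ReZi mulr2n ImD !Im_selfadjoint// addr0 oppr0 addr0.
have : (2 - F (h ^+ 2)) ^+ 2 <= 4 + rnorm h ^+ 4.
  rewrite FE; apply: (le_trans (y := normc (f (c + v)) ^+ 2)).
    by rewrite normc_sqr lerDl sqr_ge0.
  apply: (le_trans (y := rnorm (c + v) ^+ 2)).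
    by rewrite lerXn2r ?nnegrE ?normc_ge0 ?rnorm_ge0.
  rewrite -rnorm_starM E; apply: (le_trans (rnormD _ _)); apply: lerD.
    rewrite -[4%:R]mulr1 mulr_natl -scaler_nat rnormZ rnorm1 mulr1.
    by rewrite -(rmorph_nat (real_complex R)) normc_real.
  exact: rnormX.
have := sqr_ge0 (F (h ^+ 2)); rewrite -mulr_natr; nra.
Qed.

Lemma Re_sqr_ge0 h : star h = h -> 0 <= F (h ^+ 2).
Proof.
move=> hh; rewrite leNgt; apply/negP => h0.
(* For [t h] the two sides of [Re_sqr_approx] scale as [t^2] and [t^4]. This [t] gives
   [t^2 |h|^4 <= t |h|^4 <= - F (h^2)], against [- 4 F (h^2) <= t^2 |h|^4]; the added 1 keeps the
   denominator positive. *)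
pose t := Num.min 1 (- F (h ^+ 2) / (rnorm h ^+ 4 + 1)).
have n0 : 0 <= rnorm h ^+ 4 by rewrite exprn_ge0 ?rnorm_ge0.
have t0 : 0 < t by rewrite lt_min ltr01 divr_gt0 ?oppr_gt0 ?ltr_wpDl.
have := @Re_sqr_approx (t%:C *: h).
rewrite starZr hh => /(_ erefl).
rewrite exprZn -rmorphXn ReZr rnormZ.
rewrite (normc_real (ltW t0)) exprMn.
have t1 : t <= 1 by rewrite ge_min lexx.
have tK : t * (rnorm h ^+ 4 + 1) <= - F (h ^+ 2).
  by rewrite -ler_pdivlMr ?ltr_wpDl// ge_min lexx orbT.
rewrite (_ : t ^+ 4 = t ^+ 2 * t ^+ 2); last by rewrite -exprD.
have : 0 < t ^+ 2 by rewrite exprn_gt0.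
have : t ^+ 2 <= t by rewrite expr2 ler_piMl// ltW.
move: (t ^+ 2) => s st s0; rewrite -mulrN -mulrnAr -mulrA ler_pM2l//.
have := ler_wpM2r n0 st; rewrite -mulr_natr; lra.
Qed.

(** The variance of [h], that is [F] at the square of [h - F h], is nonnegative. *)
Lemma Re_sqr_ge h : star h = h -> F h ^+ 2 <= F (h ^+ 2).
Proof.
move=> hh; have := @Re_sqr_ge0 (h - (F h)%:C *: 1).
rewrite starB starZr hh star1 => /(_ erefl).
rewrite sqrrB_comm; last by rewrite /GRing.comm -scalerAl -scalerAr mul1r mulr1.
rewrite exprZn expr1n -rmorphXn -scalerAr mulr1 mulr2n !(ReD, ReN, ReZr) Re1.
by rewrite expr2; lra.
Qed.

Lemma ReMn x n : F (x *+ n) = F x *+ n.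
Proof. by elim: n => [|n IHn]; rewrite ?mulr0n ?linear0// !mulrS ReD IHn. Qed.

(* Summing [k <= (1 + k ^ 2) / 2], then the same for [k ^ 2], [k ^ 4], etc. *)
Lemma Re_sqrM_le_approx i s k : star s = s -> star k = k -> GRing.comm s k ->
  rnorm k <= 1 -> F (s ^+ 2 * k) <= F (s ^+ 2) + rnorm s ^+ 2 / 2 ^+ i.
Proof.
move=> ss; elim: i k => [|i IHi] k kk sk k1.
  rewrite expr0 divr1; apply: (le_trans (Re_le _)).
  apply: (le_trans (rnormM _ _)); apply: ler_wpDl; first exact: Re_sqr_ge0.
  rewrite -[leRHS]mulr1; apply: ler_pM; rewrite ?rnorm_ge0//.
  exact: rnormX.
have sk2 : GRing.comm s (k ^+ 2) by exact: commrX.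
have := IHi (k ^+ 2); rewrite starX kk => /(_ erefl sk2).
have k2 : rnorm (k ^+ 2) <= 1.
  by apply: (le_trans (rnormX _ _)); rewrite exprn_ile1 ?rnorm_ge0.
move=> /(_ k2).
have := @Re_sqr_ge0 (s - s * k).
rewrite starB starMr ss kk -sk => /(_ erefl).
rewrite sqrrB_comm; last by apply: commrM => //; exact: commr_refl.
rewrite exprMn_comm// mulrA -expr2 ReD ReB ReMn mulr2n.
rewrite (exprS (2 : R)) invfM mulrCA.
lra.
Qed.

(** Positivity of [F] at [s^2 (1 - k)], obtained without a square root of [1 - k]: the error
    [|s|^2 / 2^n] is at most [e] once [n > |s|^2 / e]. *)
Lemma Re_sqrM_le s k : star s = s -> star k = k -> GRing.comm s k ->
  rnorm k <= 1 -> F (s ^+ 2 * k) <= F (s ^+ 2).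
Proof.
move=> ss kk sk k1; apply/ler_addgt0Pr => e e0.
pose N := rnorm s ^+ 2 / e.
have N0 : 0 <= N by rewrite divr_ge0 ?exprn_ge0 ?rnorm_ge0// ltW.
pose n := Num.bound N.
apply: (le_trans (Re_sqrM_le_approx n ss kk sk k1)).
rewrite lerD2l ler_pdivrMr ?exprn_gt0// -ler_pdivrMl// mulrC -/N.
have Nn : N < n%:R by exact: Num.Theory.archi_boundP.
apply: (le_trans (ltW Nn)).
by rewrite -natrX ler_nat ltnW// ltn_expl.
Qed.

(** * Decrease of [F] along [(1 - k)^j k] *)

Section Descent.
Variable k : A.
Hypotheses (kk : star k = k) (k1 : rnorm k <= 1).
Let c j := F ((1 - k) ^+ j * k).

Let comm_subk j : GRing.comm ((1 - k) ^+ j) k.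
Proof.
apply/commr_sym/commrX/commrB; [exact: commr1 | exact: commr_refl].
Qed.

Let s i := (1 - k) ^+ i * k.

Let star_s i : star (s i) = s i.
Proof. by rewrite starMr starX starB star1 kk; exact/esym/comm_subk. Qed.

Let s_sqr i : s i ^+ 2 = (1 - k) ^+ i.*2 * k ^+ 2.
Proof. by rewrite exprMn_comm// -exprM muln2. Qed.

Let cS j : c j - c j.+1 = F ((1 - k) ^+ j * k ^+ 2).
Proof.
by rewrite /c -ReB exprSr -mulrA -mulrBr mulrBl mul1r subKr expr2.
Qed.

Let c_even i : c i.*2 - c i.*2.+1 = F (s i ^+ 2).
Proof. by rewrite cS s_sqr. Qed.

(** At even steps the difference of consecutive terms is a square; at odd steps it is a square times
    [1 - k], which [Re_sqrM_le] handles. *)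
Let c_odd i : c i.*2.+1 - c i.*2.+2 = F (s i ^+ 2) - F (s i ^+ 2 * k).
Proof.
rewrite cS s_sqr -ReB -mulrA -mulrBr (exprSr (1 - k)) -mulrA mulrBl mul1r.
by rewrite -exprS -exprSr.
Qed.

Let comm_sk i : GRing.comm (s i) k.
Proof. by rewrite /GRing.comm /s mulrA -comm_subk. Qed.

Let c_odd_ge0 i : c i.*2.+2 <= c i.*2.+1.
Proof. by rewrite -subr_ge0 c_odd subr_ge0 Re_sqrM_le. Qed.

Let c_even_ge0 i : c i.*2.+1 <= c i.*2.
Proof. by rewrite -subr_ge0 c_even Re_sqr_ge0. Qed.

Lemma Re_descent_le j : F ((1 - k) ^+ j * k) <= F k.
Proof.
elim: j => [|j]; first by rewrite expr0 mul1r.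
apply: le_trans; rewrite -[j]odd_double_half.
by case: (odd j); [exact: c_odd_ge0 | exact: c_even_ge0].
Qed.

(** Each even step loses [F (s n ^ 2) >= F (s n)^2], and odd steps never gain. Since
    [F (s n) <= F k <= 0], squaring reverses the order and the loss is at least [(F k)^2]. *)
Lemma Re_descent n : F k <= 0 ->
  F ((1 - k) ^+ n.*2 * k) <= - (n%:R * F k ^+ 2).
Proof.
move=> Fk; elim: n => [|n IHn].
  by rewrite double0 expr0 mul1r mul0r oppr0.
have := c_odd_ge0 n; have := c_even n; have := Re_sqr_ge (star_s n).
have : F k ^+ 2 <= F (s n) ^+ 2.
  rewrite -[leLHS]sqrrN -[leRHS]sqrrN lerXn2r ?nnegrE ?oppr_ge0 ?lerN2//.
    exact: le_trans (Re_descent_le n) Fk.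
  exact: Re_descent_le.
rewrite /c -natr1; move: IHn; lra.
Qed.

End Descent.

(** With the selfadjoint [p] and [q] of the Cartesian decomposition [2 x = p - i q], twice the sum
    of the two products is [p^2 + q^2]. *)
Lemma Re_starM_sum x : 0 <= F (star x * x) + F (x * star x).
Proof.
pose p := x + star x; pose q := 'i%C *: (x - star x).
have sp : star p = p by rewrite starD starK addrC.
have sq : star q = q by rewrite starZi starB starK -scalerN opprB.
have E : p ^+ 2 + q ^+ 2 = (star x * x + x * star x) *+ 2.
  have -> : p ^+ 2 = x * x + star x * star x + (star x * x + x * star x).
    by rewrite expr2 mulrDl !mulrDr (AC (2*2) ((1*4)*(3*2))).
  rewrite exprZn sqr_i scaleN1r.
  have -> : (x - star x) ^+ 2 =
      x * x + star x * star x - (star x * x + x * star x).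
    by rewrite expr2 mulrBl !mulrBr opprB opprD (AC (2*2) ((1*3)*(4*2))).
  by rewrite opprB addrC addrA subrK mulr2n.
have := Re_sqr_ge0 sp; have := Re_sqr_ge0 sq.
move/(congr1 (fun y => F y)) : E; rewrite ReMn !ReD mulr2n; lra.
Qed.

Lemma Re_starM_ge0_unit x : rnorm x <= 1 -> 0 <= F (star x * x).
Proof.
move=> x1; rewrite leNgt; apply/negP => h0.
pose h := star x * x; pose k := x * star x.
have hh : star h = h by rewrite starMr starK.
have kk : star k = k by rewrite starMr starK.
have nx : rnorm x ^+ 2 <= 1 by rewrite exprn_ile1 ?rnorm_ge0.
have h1 : rnorm h <= 1 by rewrite rnorm_starM.
have k1 : rnorm k <= 1 by rewrite /k -{1}[x]starK rnorm_starM rnorm_star.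
have xh : GRing.comm (1 - h) h.
  by apply/commr_sym/commrB; [exact: commr1 | exact: commr_refl].
have key n : 0 <= F ((1 - h) ^+ n.*2 * h) + F ((1 - k) ^+ n.*2 * k).
  pose d := (1 - h) ^+ n.
  have dd : star d = d by rewrite starX starB star1 hh.
  have hd : h * d = d * h by exact/commrX/commr_sym.
  have := Re_starM_sum (x * d); rewrite starMr dd.
  have -> : d * star x * (x * d) = (1 - h) ^+ n.*2 * h.
    rewrite mulrA -(mulrA d) -/h -mulrA hd mulrA.
    by rewrite -exprD addnn.
  have -> : x * d * (d * star x) = (1 - k) ^+ n.*2 * k.
    rewrite mulrA -(mulrA x) -exprD addnn.
    (* [x] intertwines [h] and [k]: both [x h] and [k x] are [x x^* x]. *)
    have -> m : x * (1 - h) ^+ m = (1 - k) ^+ m * x.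
      elim: m => [|m IHm]; first by rewrite !expr0 mulr1 mul1r.
      rewrite exprSr mulrA IHm exprSr -!mulrA; congr (_ * _).
      by rewrite mulrBr mulrBl mulr1 mul1r mulrA.
    by rewrite -mulrA.
  by [].
(* For this [n] the [h]-term of [key] is below -1, while the [k]-term is at most [F k <= 1]. *)
pose n := Num.bound (F h ^+ 2)^-1.
have nb : (F h ^+ 2)^-1 < n%:R.
  by apply: Num.Theory.archi_boundP; rewrite invr_ge0 sqr_ge0.
have := key n; have := Re_descent_le kk k1 n.*2.
have := Re_descent hh h1 n (ltW h0).
have : 1 < n%:R * F h ^+ 2.
  by rewrite -ltr_pdivrMr ?mul1r// exprn_even_gt0//= lt_eqF.
have := le_trans (Re_le k) k1; lra.
Qed.

Lemma Re_starM_ge0 x : 0 <= F (star x * x).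
Proof.
have [x0|x0] := eqVneq (rnorm x) 0.
  by apply: Re_starM_ge0_unit; rewrite x0.
have {}x0 : 0 < rnorm x by rewrite lt_def x0 rnorm_ge0.
have := @Re_starM_ge0_unit ((rnorm x)^-1%:C *: x).
rewrite rnormZ normc_real; last by rewrite invr_ge0 ltW.
rewrite mulVf ?gt_eqF// => /(_ (lexx _)).
by rewrite starZr -scalerAl -scalerAr !ReZr !pmulr_rge0 ?invr_gt0.
Qed.

Lemma Re_star x : F (star x) = F x.
Proof.
have : complex.Im (f ('i%C *: (x - star x))) = 0.
  by apply: Im_selfadjoint => //; rewrite starZi starB starK -scalerN opprB.
by rewrite ImZi ReB => /eqP; rewrite subr_eq0 => /eqP.
Qed.

Lemma Im_star x : complex.Im (f (star x)) = - complex.Im (f x).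
Proof.
apply/eqP; rewrite -addr_eq0 -ImD Im_selfadjoint//.
by rewrite starD starK addrC.
Qed.

Lemma ReZ (z : R[i]) x :
  F (z *: x) = complex.Re z * F x - complex.Im z * complex.Im (f x).
Proof. by rewrite linearZ_LR; case: z (f x) => a b []. Qed.

(** Positivity at [x - f x], expanded with [f 1 = 1]. *)
Lemma functional_cauchy_schwarz x : normc (f x) ^+ 2 <= F (star x * x).
Proof.
set c := f x; have := Re_starM_ge0 (x - c *: 1).
rewrite starB starZ star1 mulrBl !mulrBr -!scalerAl -!scalerAr !mul1r !mulr1.
rewrite scalerA opprB !(ReB, ReD) !ReZ Re_star Im_star -/c Re1 f1 normc_sqr.
by case: (c) => a b /=; lra.
Qed.

Lemma unital_contractive_positive : positive_functional f.
Proof.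
move=> x; rewrite lecE Re_starM_ge0// Im_selfadjoint ?eqxx//.
by rewrite starMr starK.
Qed.

Lemma unital_contractive_continuous : continuous f.
Proof.
apply/linear_bounded_continuous/linear_boundedP; exists 1.
split; first exact: real1.
move=> r r1 x; rewrite (@le_trans _ _ `|x|)//; last first.
  by rewrite ler_peMl// ltW.
by rewrite [leRHS]rnormE; move: (f_le x); rewrite -lecR.
Qed.

Lemma unital_contractive_state : state_space f.
Proof.
split=> //; [exact: unital_contractive_continuous
            | exact: unital_contractive_positive | ].
have ub : ubound [set normc (f x) | x in [set x | `|x| <= 1]]%classic 1.
  by move=> _ [x /= + <-]; rewrite rnormE lecR; apply/le_trans.
have one : [set normc (f x) | x in [set x | `|x| <= 1]]%classic 1.
  exists 1; first by rewrite /= rnormE rnorm1.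
  by rewrite f1 ComplexField.Normc.normc1.
apply/eqP; rewrite eq_le; apply/andP; split.
  by apply: ge_sup => //; exists 1.
by apply: ub_le_sup => //; exists 1.
Qed.

End UnitalContractiveFunctional.

(** * States attaining both radii *)

Section States.
Context (R : realType) (A : cstarAlgType R).
Implicit Types (a x : A) (f : {linear A -> R[i]^o}).
Local Open Scope complex_scope.
Local Notation normc := ComplexField.Normc.normc.

Lemma state_contractive f x : state_space f -> normc (f x) <= rnorm x.
Proof.
move=> [_ _ f_norm _].
(* [sup] defaults to 0 where no supremum exists, so a dual norm equal to 1 forces boundedness. *)
have [_ fub] : has_sup [set normc (f x) | x in [set x | `|x| <= 1]]%classic.
  apply: contrapT => /sup_out; rewrite -/(dual_norm f) f_norm.
  exact/eqP/oner_neq0.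
have [x0|x0] := eqVneq x 0.
  by rewrite x0 linear0 ComplexField.Normc.normc0 rnorm_ge0.
have {}x0 : 0 < rnorm x by rewrite -ltcR -rnormE normr_gt0.
have e : normc (rnorm x)^-1%:C = (rnorm x)^-1.
  by rewrite normc_real// invr_ge0 ltW.
have : normc (f ((rnorm x)^-1%:C *: x)) <= 1.
  rewrite -f_norm; apply: ub_le_sup => //; exists ((rnorm x)^-1%:C *: x) => //=.
  by rewrite rnormE rnormZ e mulVf ?gt_eqF.
rewrite linearZ_LR [normc _]ComplexField.Normc.normcM e.
by rewrite ler_pdivrMl// mulr1.
Qed.

Lemma norm_parallel1_state a : norm_parallel a 1 ->
  exists2 f, state_space f & normc (f a) = rnorm a.
Proof.
move=> [l [l1 al]].
have nl : normc l = 1 by apply: complexI; rewrite -normr_normc l1.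
have [g [g_le gb]] := exists_norming_functional (a + l *: 1).
have alE : rnorm (a + l *: 1) = rnorm a + 1.
  by apply: complexI; rewrite rmorphD /= -!rnormE al [`|1 : A|]rnormE rnorm1.
pose f : {linear A -> R[i]^o} := l \*: g.
have fE x : f x = l * g x by [].
have f_le x : normc (f x) <= rnorm x.
  by rewrite fE ComplexField.Normc.normcM nl mul1r.
have Re_sum : complex.Re (g a) + complex.Re (f 1) = rnorm a + 1.
  by rewrite -alE -gb ReD linearZ_LR.
have ga : complex.Re (g a) <= rnorm a by exact: le_trans (Re_le_normc _) _.
have f1_le : normc (f 1) <= 1 by rewrite -(rnorm1 A).
have Ref1 := Re_le_normc (f 1).
(* The real parts of [g a] and [f 1] are at most [|a|] and 1 and add up to [|a| + 1], so both bounds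
   are attained. *)
have {}Ref1 : complex.Re (f 1) = 1 by lra.
have f1 : f 1 = 1.
  apply/eqP; rewrite eq_complex Ref1 eqxx /= -sqrf_eq0 eq_le sqr_ge0 andbT.
  have := normc_sqr (f 1); rewrite Ref1.
  have : normc (f 1) ^+ 2 <= 1 by rewrite exprn_ile1 ?normc_ge0.
  by lra.
exists f; first exact: unital_contractive_state.
apply/eqP; rewrite eq_le f_le fE ComplexField.Normc.normcM nl mul1r.
by apply: le_trans (Re_le_normc (g a)); lra.
Qed.

Lemma sup_image_max (T : Type) (S : set T) (g : T -> R) (t : T) :
  S t -> (forall s, S s -> g s <= g t) -> sup [set g s | s in S]%classic = g t.
Proof.
move=> St gt; apply/eqP; rewrite eq_le; apply/andP; split.
  by apply: ge_sup; [exists (g t); exists t | move=> _ [s Ss <-]; exact: gt].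
by apply: ub_le_sup; [exists (g t) => _ [s Ss <-]; exact: gt | exists t].
Qed.

Lemma Re_starM_le f x : state_space f ->
  complex.Re (f (star x * x)) <= rnorm x ^+ 2.
Proof.
move=> sf; rewrite -rnorm_starM; apply: le_trans (Re_le_normc _) _.
exact: state_contractive.
Qed.

Lemma norm_parallel1_radii a : norm_parallel a 1 ->
  numerical_radius a = rnorm a /\
  davis_wielandt_radius a = Num.sqrt (rnorm a ^+ 2 + rnorm a ^+ 4).
Proof.
move=> /norm_parallel1_state[f sf fa].
have fe x g : state_space g -> normc (g x) <= rnorm x.
  exact: state_contractive.
(* Cauchy-Schwarz and contractivity squeeze it: [|a|^2 = |f a|^2 <= f (a^* a) <= |a|^2]. *)
have faa : complex.Re (f (star a * a)) = rnorm a ^+ 2.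
  apply/eqP; rewrite eq_le Re_starM_le//= -fa.
  have [_ _ _ f1] := sf.
  by apply: functional_cauchy_schwarz => // x; exact: fe.
split; first by rewrite -fa; apply: sup_image_max => // g sg; rewrite fa fe.
rewrite (_ : rnorm a ^+ 4 = (rnorm a ^+ 2) ^+ 2); last by rewrite -exprM.
rewrite -[in X in _ + X ^+ 2]faa -fa.
pose dw (g : {linear A -> R[i]^o}) :=
  Num.sqrt (normc (g a) ^+ 2 + complex.Re (g (star a * a)) ^+ 2).
rewrite /davis_wielandt_radius.
rewrite (@sup_image_max _ _ dw f sf)//.
move=> g sg; apply: ler_wsqrtr; apply: lerD.
  by rewrite lerXn2r ?nnegrE ?normc_ge0// fa fe.
(* Monotonicity of squaring leaves [0 <= Re (g (a^* a))] to prove, which is positivity of [g]. *)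
rewrite faa lerXn2r ?nnegrE ?exprn_ge0 ?rnorm_ge0 ?Re_starM_le//.
have [_ /(_ a) + _ _] := sg.
by rewrite lecE => /andP[].
Qed.

End States.

Theorem theorem4p10 (R : realType) (A : cstarAlgType R) (a : A)
    (ha : a != 0) (hpar : norm_parallel a 1) :
  `|a| = 1 <->
  davis_wielandt_radius a = Num.sqrt 2 * numerical_radius a.
Proof.
have [-> ->] := norm_parallel1_radii hpar.
have N0 : 0 < rnorm a by rewrite -ltcR -rnormE normr_gt0.
rewrite rnormE; move: (rnorm a) N0 => N N0.
(* With [N] written as the root of [N^2], the second condition compares two roots and amounts to
   [N^2 + N^4 = 2 N^2]. *)
rewrite -[X in _ * X](ger0_norm (ltW N0)) -sqrtr_sqr -sqrtrM//.
split=> [/complexI ->|/eqP]; first by rewrite !expr1n mulr1.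
rewrite eqr_sqrt ?addr_ge0 ?mulr_ge0 ?exprn_ge0 ?(ltW N0)//.
move=> /eqP e; congr (_%:C)%C; apply/eqP; rewrite -sqrp_eq1 ?(ltW N0)//.
apply/eqP; have N2 : N ^+ 2 != 0 by rewrite expf_neq0 ?gt_eqF.
(* Dividing by [N^2], nonzero because [a] is, leaves [N^2 = 1]. *)
by apply: (mulfI N2); rewrite -exprD; lra.
Qed.
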